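(* The atomic geometrically griddable classes are precisely the classes $\operatorname{Geom}(M)$ where $M$ is a $\bullet$-isolated matrix with entries in $\{0,\bullet,1,-1\}$. Moreover, every geometrically griddable class can be expressed as a finite union of classes of the form $\operatorname{Geom}(M)$ with $M$ a $\bullet$-isolated matrix with entries in $\{0,\bullet,1,-1\}$.
   Context: A permutation of length $n\ge 0$ is a bijection of $\{1,\dots,n\}$, written in one-line notation. A permutation $\pi$ of length $n$ contains a permutation $\sigma$ of length $k$ (written $\sigma\le\pi$) if $\pi$ has a subsequence of length $k$ that is order isomorphic to $\sigma$. A permutation class is a set of permutations that is downward closed under $\le$. A nonempty permutation class $\mathcal{C}$ is atomic (join-irreducible) if there are no two permutation classes $\mathcal{D},\mathcal{E}\subsetneq\mathcal{C}$ with $\mathcal{C}=\mathcal{D}\cup\mathcal{E}$. Matrices are indexed first by column (left to right) and then by row (bottom to top). For a figure $\mathcal{F}\subseteq\mathbb{R}^2$, let $\operatorname{Sub}(\mathcal{F})$ be the set of all permutations obtained as follows: choose finitely many points of $\mathcal{F}$, no two on a common horizontal or vertical line, label them $1,\dots,n$ from bottom to top, and read the labels from left to right. For a matrix $M$ with entries in $\{0,1,-1\}$, $\operatorname{Geom}(M)=\operatorname{Sub}(\Lambda)$, where the standard figure $\Lambda$ of $M$ consists of the open line segment from $(k-1,\ell-1)$ to $(k,\ell)$ for each $(k,\ell)$ with $M_{k,\ell}=1$ and the open line segment from $(k-1,\ell)$ to $(k,\ell-1)$ for each $(k,\ell)$ with $M_{k,\ell}=-1$. A permutation class is geometrically griddable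 if it is contained in $\operatorname{Geom}(M)$ for some matrix $M$ with entries in $\{0,1,-1\}$. A matrix $M$ with entries in $\{0,\bullet,1,-1\}$ is $\bullet$-isolated if every $\bullet$ entry is the only nonzero entry in its column and in its row. For such $M$, the standard figure consists of the single point $(k-\tfrac12,\ell-\tfrac12)$ for each $(k,\ell)$ with $M_{k,\ell}=\bullet$, the line segment from $(k-1,\ell-1)$ to $(k,\ell)$ for each $(k,\ell)$ with $M_{k,\ell}=1$, and the line segment from $(k-1,\ell)$ to $(k,\ell-1)$ for each $(k,\ell)$ with $M_{k,\ell}=-1$; $\operatorname{Geom}(M)$ is defined as $\operatorname{Sub}$ of this standard figure. *)

(* Defs.v *)
From HB Require Import structures.
From mathcomp Require Import all_boot all_order all_algebra perm.
From mathcomp Require Import boolp classical_sets set_interval reals.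

Set Implicit Arguments.
Unset Strict Implicit.
Unset Printing Implicit Defensive.

Import Order.TTheory GRing.Theory Num.Theory.

Local Open Scope classical_set_scope.
Local Open Scope ring_scope.

(* Positions and values are numbered from 0. *)
Definition permutation : Type := {n : nat & 'S_n}.

Definition values (pi : permutation) : 'S_(tag pi) := tagged pi.

Definition contains (pi sigma : permutation) : Prop :=
  exists f : 'I_(tag sigma) -> 'I_(tag pi),
    {mono f : i j / (i < j)%N} /\
    forall i j, (values pi (f i) < values pi (f j))%N
              = (values sigma i < values sigma j)%N.

(* The empty set is a permutation class. *)
Definition permutation_class (C : set permutation) : Prop :=
  forall pi sigma, C pi -> contains pi sigma -> C sigma.

Definition atomic (C : set permutation) : Prop :=
  [/\ permutation_class C, C !=set0 &
      ~ exists D E : set permutation,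
          [/\ permutation_class D, permutation_class E,
              D `<` C, E `<` C & C = D `|` E]].

(* [p] lists the chosen points from left to right, and [pi i] is the label of
   [p i] in the bottom-to-top order; since [pi] is injective, the last clause
   also says that no two of the points lie on a common horizontal line. *)
Definition SubFigure (R : realType) (F : set (R * R)) : set permutation :=
  [set pi | exists p : 'I_(tag pi) -> R * R,
     [/\ forall i, F (p i),
         forall i j, ((p i).1 < (p j).1) = (i < j)%N &
         forall i j, ((p i).2 < (p j).2) = (values pi i < values pi j)%N]].

Definition segment_point (R : realType) (a b : R * R) (t : R) : R * R :=
  ((1 - t) * a.1 + t * b.1, (1 - t) * a.2 + t * b.2).

Definition open_segment (R : realType) (a b : R * R) : set (R * R) :=
  [set segment_point a b t | t in `]0, 1[].

Definition closed_segment (R : realType) (a b : R * R) : set (R * R) :=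
  [set segment_point a b t | t in `[0, 1]].

Inductive entry : Type := Zero | Bullet | Plus | Minus.

(* In [M k l] the first index [k] is the column, from left to right, and the
   second index [l] is the row, from bottom to top. Both start at 0, so that
   this entry governs the unit square with lower left corner (k, l). *)
Definition figure_of (R : realType) (seg : R * R -> R * R -> set (R * R))
    (m n : nat) (M : 'M[entry]_(m, n)) : set (R * R) :=
  [set p | exists (k : 'I_m) (l : 'I_n),
     match M k l with
     | Zero => False
     | Bullet => p = (k%:R + 2^-1, l%:R + 2^-1)
     | Plus => seg (k%:R, l%:R) (k.+1%:R, l.+1%:R) p
     | Minus => seg (k%:R, l.+1%:R) (k.+1%:R, l%:R) p
     end].

Definition bullet_free (m n : nat) (M : 'M[entry]_(m, n)) : Prop :=
  forall k l, M k l <> Bullet.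

Definition bullet_isolated (m n : nat) (M : 'M[entry]_(m, n)) : Prop :=
  forall k l, M k l = Bullet ->
    (forall l', l' <> l -> M k l' = Zero) /\
    (forall k', k' <> k -> M k' l = Zero).

(* For bullet-free matrices: the standard figure is made of open segments. *)
Definition Geom (R : realType) (m n : nat) (M : 'M[entry]_(m, n)) :
    set permutation :=
  SubFigure (figure_of (@open_segment R) M).

(* For bullet-isolated matrices: the segments contain their endpoints. On
   bullet-free matrices this is the same class as [Geom], because a chosen
   endpoint can be moved slightly into its segment. *)
Definition Geom_bullet (R : realType) (m n : nat) (M : 'M[entry]_(m, n)) :
    set permutation :=
  SubFigure (figure_of (@closed_segment R) M).

Definition geometrically_griddable (R : realType) (C : set permutation) : Prop :=
  permutation_class C /\
  exists (m n : nat) (M : 'M[entry]_(m, n)), bullet_free M /\ C `<=` Geom R M.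

(* Main.v *)
Require Import Defs.
From mathcomp Require Import all_boot all_order all_algebra perm.
From mathcomp Require Import boolp classical_sets set_interval reals.
From mathcomp Require Import lra zify.

Set Implicit Arguments.
Unset Strict Implicit.
Unset Printing Implicit Defensive.

Import Order.TTheory GRing.Theory Num.Theory.

Local Open Scope classical_set_scope.

(** A stroke of slope +1 or -1 in a unit cell, cut at its centre, becomes two
    half-strokes, each running from a corner of the cell to its centre. On a
    half-stroke the point at time [s] has both coordinates determined by [s]:
    each half-column and each half-row is traversed in a fixed direction, the
    same for all its half-strokes, as if the plane had been folded along the
    integer and half-integer lines. Hence finitely many chosen points of the
    figure are described, as far as the order of their coordinates goes, by the
    word that lists their half-cells in order of time. Ties in time need no
    care: chosen points with the same time lie in different half-columns and
    half-rows, so their relative position does not depend on how the tie is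
    broken.

    For a class [C] inside [Geom M], the words all of whose drawings belong to
    [C] form a language closed under subwords. Such a language is a finite union
    of patterns, that is, of products whose factors are the words over a set of
    letters or a letter that may be omitted ([finite_union_patterns]). This is
    where well-quasi-ordering enters: if a pattern is not inside the language, a
    missing word allows it to be replaced by finitely many patterns that are
    smaller in a well-founded order. Cutting time into one interval per factor
    of a pattern turns the pattern into a bullet-isolated matrix
    ([gridding]): a starred factor gives diagonal segments in the cells of its
    letters, an optional letter gives one bullet. The permutations drawn by the
    words of the pattern are exactly the class of this matrix
    ([strokes_draws], [draws_strokes], [Geom_bullet_gridding]), and [C] is the
    union of these classes ([griddable_decomposition]). If [C] is atomic, one
    of them is already all of [C] ([atomic_sub_bigcup]).

    Conversely, let [M] be bullet-isolated. Two permutations of its class are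
    realised together by letting the half-strokes of one be traversed during an
    early interval of time and those of the other during a later one
    ([joint_embedding]). The bullets stay where they are: since a bullet is
    alone in its column and its row, no other point is compared with it inside
    its column or row. Joint embedding gives atomicity. The same change of time
    moves points off the ends of their segments, so the class lies in the class
    of the matrix with bullets replaced by segments. *)

(** * Downward closed languages *)

Section Patterns.
Variable T : finType.
Implicit Types (x : T + {set T}) (F G H : seq (T + {set T})) (u v w : seq T).
Implicit Types (A : {set T}).

(** A pattern is a sequence of factors: [inl a] stands for the words empty and
    [a], and [inr A] for all words over [A]. *)
Definition fits x u : bool :=
  match x with inl a => subseq u [:: a] | inr A => all [in A] u end.

Definition lang F w : Prop :=
  exists2 ws : seq (seq T), all2 fits F ws & w = flatten ws.

Definition weight x : nat := match x with inl _ => 0 | inr A => #|A|.+1 end.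

(** One factor is replaced by any number of strictly lighter ones: the multiset
    order, kept on sequences because patterns are not commutative. *)
Inductive lighter : seq (T + {set T}) -> seq (T + {set T}) -> Prop :=
| lighter_head x F H : (forall y, y \in H -> weight y < weight x) ->
    lighter (H ++ F) (x :: F)
| lighter_tail x F G : lighter G F -> lighter (x :: G) (x :: F).

(** By induction on the weight of [x], adding [x] in front of an accessible
    pattern keeps it accessible: replacing [x] adds only lighter factors, one at a
    time, and a step inside the tail is covered by the accessibility of the tail. *)
Lemma lighter_wf : well_founded lighter.
Proof.
have accC : forall n x F,
    weight x < n -> Acc lighter F -> Acc lighter (x :: F); last first.
  elim=> [|x F IH]; last exact: accC (ltnSn _) IH.
  by constructor=> G lGF; inversion lGF.
elim=> [x F|n IHn x F]; first by rewrite ltn0.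
rewrite ltnS => le_xn accF.
elim: accF => {}F accF IHF; constructor=> G lG; inversion lG; subst; last first.
  exact: IHF.
have {}accF: Acc lighter F by constructor.
elim: H {IHF lG} H2 => [_|y H IHH ltH]; first exact: accF.
apply: IHn.
  by apply: leq_trans le_xn; apply: ltH; rewrite mem_head.
by apply: IHH => z zH; apply: ltH; rewrite inE zH orbT.
Qed.

Lemma fits_nil x : fits x [::]. Proof. by case: x. Qed.

Lemma lang_nil F : lang F [::].
Proof.
exists (nseq (size F) [::]); last by elim: F.
by elim: F => //= x F ->; rewrite fits_nil.
Qed.

Lemma lang_cons x F w :
  lang (x :: F) w <-> exists u v, [/\ fits x u, lang F v & w = u ++ v].
Proof.
split=> [[[|u ws] //= /andP[xu Fws] ->]|[u [v [xu [ws Fws ->] ->]]]].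
  by exists u, (flatten ws); split=> //; exists ws.
by exists (u :: ws); rewrite //= xu.
Qed.

Lemma lang_cat F G w :
  lang (F ++ G) w <-> exists u v, [/\ lang F u, lang G v & w = u ++ v].
Proof.
elim: F w => [|x F IH] w.
  split=> [Gw|[u [v [[ws]]]]]; last by case: ws => //= _ -> Gv ->.
  by exists [::], w; split=> //; apply: lang_nil.
rewrite lang_cons; split=> [[u [v [xu /IH[v1 [v2 [Fv1 Gv2 ->]]] ->]]]|].
  by exists (u ++ v1), v2; split=> //; [apply/lang_cons; exists u, v1|rewrite catA].
move=> [u [v [/lang_cons[u1 [u2 [xu1 Fu2 ->]]] Gv ->]]].
exists u1, (u2 ++ v); split=> //; last by rewrite catA.
by apply/IH; exists u2, v.
Qed.

(** A word over [A] that does not contain [v] is read by matching the letters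
    of [v] greedily. The match gets stuck, and before it meets the letter [c] the
    word cannot use [c]. *)
Fixpoint avoiding A v : seq (T + {set T}) :=
  if v is c :: v' then [:: inr (A :\ c), inl c & avoiding A v'] else [::].

Lemma avoidingP A v u :
  all [in A] u -> ~~ subseq v u -> lang (avoiding A v) u.
Proof.
elim: v u => [|c v IH] u Au; first by rewrite sub0seq.
have inAc s : all [in A] s -> c \notin s -> all [in A :\ c] s.
  move=> /allP As cs; apply/allP=> z zs; rewrite !inE As // andbT.
  by apply: contraNneq cs => <-.
have [cu|cu _] := boolP (c \in u); last first.
  apply/lang_cons; exists u, [::]; rewrite cats0; split=> //; last exact: lang_nil.
  exact: inAc.
have cu' : c \notin take (index c u) u by rewrite in_take_leq ?ltnn // index_size.
move: Au; rewrite -(cat_take_drop (index c u) u) (drop_index cu) all_cat.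
move: (take _ _) cu' (drop _ _) => u1 cu1 u2 /andP[Au1 /= /andP[_ Au2]] nvu.
apply/lang_cons; exists u1, (c :: u2); split=> //; first exact: inAc.
apply/lang_cons; exists [:: c], u2; split=> //=; first by rewrite eqxx.
apply: IH => //; apply: contra nvu => vu2.
by apply: subseq_trans (suffix_subseq _ _); rewrite /= eqxx.
Qed.

(** Replacing [inr A] by [avoiding A v] does not leave the words over [A]. *)
Lemma avoiding_sub A v u : lang (avoiding A v) u -> all [in A] v -> all [in A] u.
Proof.
elim: v u => [|c v IH] u; first by case=> [[|//]] _ ->.
move=> /lang_cons[u1 [u' [/= Au1 /lang_cons[u2 [u3 [/= cu2 Lu3 ->]]] ->]]].
case/andP=> Ac Av; rewrite !all_cat (IH _ Lu3 Av) andbT; apply/andP; split.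
  by apply: sub_all Au1 => z; rewrite !inE => /andP[].
by apply/allP=> z /(mem_subseq (cu2 : subseq u2 [:: c])); rewrite inE => /eqP->.
Qed.

Lemma avoiding_weight A v y : all [in A] v ->
  y \in avoiding A v -> weight y < #|A|.+1.
Proof.
elim: v => //= c v IH /andP[Ac Av]; rewrite !inE => /or3P[/eqP->|/eqP->|] //=.
  by rewrite ltnS (cardsD1 c A) Ac.
exact: IH.
Qed.

(** [vs] is a missing word cut along the factors of [F]. A word of [F] that does
    not contain it fails to contain one of the pieces inside the corresponding
    factor, and each choice of that factor gives one refined pattern. An optional
    letter that does not contain its piece must be omitted. *)
Fixpoint refinements F (vs : seq (seq T)) : seq (seq (T + {set T})) :=
  match F, vs with
  | x :: F', v :: vs' =>
      ((if x is inr A then avoiding A v else [::]) ++ F')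
        :: [seq x :: G | G <- refinements F' vs']
  | _, _ => [::]
  end.

Lemma refinements_lighter F vs G :
  all2 fits F vs -> G \in refinements F vs -> lighter G F.
Proof.
elim: F vs G => [|x F IH] [|v vs] G //= /andP[xv Fvs]; rewrite inE.
case/orP=> [/eqP->|/mapP[G' /(IH _ _ Fvs) G'F ->]]; last exact: lighter_tail.
by apply: lighter_head; case: x xv => // A Av y; apply: avoiding_weight.
Qed.

Lemma refinements_sub F vs G w :
  all2 fits F vs -> G \in refinements F vs -> lang G w -> lang F w.
Proof.
elim: F vs G w => [|x F IH] [|v vs] G w //= /andP[xv Fvs]; rewrite inE.
case/orP=> [/eqP->|/mapP[G' G'F ->]]; last first.
  move=> /lang_cons[u1 [u2 [xu1 Gu2 ->]]].
  by apply/lang_cons; exists u1, u2; split=> //; apply: (IH _ _ _ Fvs G'F).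
case/lang_cat=> u1 [u2 [Lu1 Fu2 ->]]; apply/lang_cons; exists u1, u2; split=> //.
case: x xv Lu1 => [a _|A Av Lu1]; last exact: avoiding_sub Lu1 Av.
by case=> [[|//]] _ ->.
Qed.

(** Were each piece of the first word a subword of the piece of the second one
    in the same factor, concatenation would make the whole a subword. *)
Lemma refinementsP F vs ws :
    all2 fits F vs -> all2 fits F ws -> ~~ subseq (flatten vs) (flatten ws) ->
  exists2 G, G \in refinements F vs & lang G (flatten ws).
Proof.
elim: F vs ws => [|x F IH] [|v vs] [|w ws] //= /andP[xv Fvs] /andP[xw Fws] nvw.
have [vw|nv] := boolP (subseq v w); last first.
  eexists; first exact: mem_head.
  apply/lang_cat; exists w, (flatten ws); split=> //; last by exists ws.
  case: x xv xw => [a va wa|A _ Aw]; last exact: avoidingP.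
  (* a nonempty [w] would be the word [a], which contains [v] *)
  suff ->: w = [::] by apply: lang_nil.
  move: nv wa; case: w {nvw} => // c w nv wa; case/negP: nv.
  suff -> : c :: w = [:: a] by [].
  by apply/eqP; rewrite -(geq_leqif (size_subseq_leqif wa)).
have /(IH _ _ Fvs Fws)[G GF Gw] : ~~ subseq (flatten vs) (flatten ws).
  by apply: contra nvw => /(cat_subseq vw).
exists (x :: G); first by rewrite inE map_f ?orbT.
by apply/lang_cons; exists w, (flatten ws).
Qed.

(** Either [F] is inside [L], or a word of [F] outside [L] is a subword of no
    word of [L], so that [F] may be replaced by its refinements. *)
Lemma finite_union_patterns (L : seq T -> Prop) F :
  (forall u v, subseq u v -> L v -> L u) ->
  exists Fs : seq (seq (T + {set T})),
    forall w, (lang F w /\ L w) <-> exists2 G, G \in Fs & lang G w.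
Proof.
move=> Lsub; elim/(well_founded_ind lighter_wf): F => F IH.
have [FL|] := pselect (forall w, lang F w -> L w).
  exists [:: F] => w; split=> [[Fw _]|[G]]; first by exists F; rewrite ?mem_head.
  by rewrite inE => /eqP-> Fw; split=> //; apply: FL.
move/existsNP=> [v /not_implyP[[vs Fvs ->] nLv]].
have [Fs FsP] : exists Fs : seq (seq (T + {set T})), forall w,
    (exists2 G, G \in refinements F vs & lang G w /\ L w) <->
    exists2 G, G \in Fs & lang G w.
  have := refinements_lighter Fvs; elim: (refinements F vs) => [_|G Gs IHG ltF].
    by exists [::] => w; split=> -[].
  have /IHG[Fs1 Fs1P] : forall G', G' \in Gs -> lighter G' F.
    by move=> G' G'Gs; apply: ltF; rewrite inE G'Gs orbT.
  have [Fs2 Fs2P] := IH G (ltF G (mem_head _ _)).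
  exists (Fs2 ++ Fs1) => w; split.
    case=> G'; rewrite inE => /predU1P[->|G'Gs] Gw.
      by have [H HFs Hw] := (Fs2P w).1 Gw; exists H; rewrite ?mem_cat ?HFs.
    have [|H HFs Hw] := (Fs1P w).1; first by exists G'.
    by exists H; rewrite ?mem_cat ?HFs ?orbT.
  case=> H; rewrite mem_cat => /orP[HFs|HFs] Hw.
    by exists G; rewrite ?mem_head //; apply/Fs2P; exists H.
  have [|G' G'Gs Gw] := (Fs1P w).2; first by exists H.
  by exists G'; rewrite // inE G'Gs orbT.
exists Fs => w; rewrite -FsP; split=> [[[ws Fws ->] Lw]|[G GF [Gw Lw]]].
  have [|G GF Gw] := refinementsP Fvs Fws; last by exists G.
  by apply/negP=> /Lsub/(_ Lw).
by split=> //; apply: refinements_sub Fvs GF Gw.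
Qed.

End Patterns.

(** * Zigzag coordinates *)

Section Zigzag.
Local Open Scope ring_scope.
Variable R : realType.
Implicit Types (s t : R) (K L k l : nat).

Definition orient (b : bool) t : R := if b then 1 - t else t.

(** A point moving during time [0, 1] across the [K]-th unit interval, to the
    right if [K] is even and to the left if [K] is odd: consecutive intervals are
    traversed in opposite directions, and [zig] unfolds the line. *)
Definition zig K s : R := K%:R + orient (odd K) s.

(** The order of [zig K s] and [zig K' s'], expressed by the intervals and by
    the truth values [lt] of [s < s'] and [gt] of [s' < s]. Passing truth values
    lets the same relation compare times, which are reals, and positions in a
    word, which are naturals. *)
Definition zig_order K K' (lt gt : bool) : bool :=
  (K < K')%N || ((K == K') && if odd K then gt else lt).

(** Adjacent closed intervals share an endpoint, so at the times 0 and 1 only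
    this implication holds. *)
Lemma zig_lt_order K K' s s' : 0 <= s <= 1 -> 0 <= s' <= 1 ->
  zig K s < zig K' s' -> zig_order K K' (s < s') (s' < s).
Proof.
rewrite /zig_order /zig => s01 s'01; case: ltngtP => //= [ltK|<-].
  have : K'.+1%:R <= K%:R :> R by rewrite ler_nat.
  rewrite -natr1 /orient; case: (odd K); case: (odd K'); lra.
by rewrite /orient; case: (odd K) => //; lra.
Qed.

Lemma zig_ltE K K' s s' : 0 < s < 1 -> 0 < s' < 1 ->
  (zig K s < zig K' s') = zig_order K K' (s < s') (s' < s).
Proof.
move=> s01 s'01; apply/idP/idP; first by apply: zig_lt_order; lra.
rewrite /zig_order /zig; case: ltngtP => //= [ltK _|<-].
  have : K.+1%:R <= K'%:R :> R by rewrite ler_nat.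
  rewrite -natr1 /orient; case: (odd K); case: (odd K'); lra.
by rewrite /orient; case: (odd K) => //; lra.
Qed.

Definition zigfig (strokes : nat -> nat -> R -> Prop) : set (R * R) :=
  [set p | exists K L s,
     [/\ 0 <= s <= 1, strokes K L s & p = (zig K s, zig L s)]].

(** Permutations only see the order of the coordinates. *)
Lemma SubFigure_rescale (c : R) (F G : set (R * R)) : 0 < c ->
  (forall p, F p -> G (c * p.1, c * p.2)) -> SubFigure F `<=` SubFigure G.
Proof.
move=> c0 FG pi [p [Fp px py]]; exists (fun i => (c * (p i).1, c * (p i).2)).
by split=> [i|i j|i j] /=; [apply: FG | rewrite ltr_pM2l | rewrite ltr_pM2l].
Qed.

Section Folding.
Variables (m n : nat) (M : 'M[entry]_(m, n)).

(** The figure of [M] scaled by 2, whose cell [(k, l)] consists of the four unit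
    squares [(K, L)] with [K./2 = k] and [L./2 = l]. A diagonal crosses two of
    them; both coordinates move with the same time, from the boundary of the cell
    at time 0 to its centre at time 1. The centre is the end of all four squares,
    and a bullet is recorded in the lower left one. *)
Definition folded_in (k : 'I_m) (l : 'I_n) K L s : Prop :=
  match M k l with
  | Zero => False
  | Bullet => [/\ K = k.*2, L = l.*2 & s = 1]
  | Plus => [/\ K./2 = k, L./2 = l & odd K = odd L]
  | Minus => [/\ K./2 = k, L./2 = l & odd K = ~~ odd L]
  end.

Definition folded K L s : Prop := exists (k : 'I_m) (l : 'I_n), folded_in k l K L s.

Lemma zig_bit (b : bool) k s : zig (b + k.*2) s = 2 * (k%:R + orient b (s / 2)).
Proof.
rewrite /zig natrD oddD odd_double oddb addbF -muln2 natrM.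
by case: b => /=; lra.
Qed.

Lemma zig_double k s : zig k.*2 s = 2 * k%:R + s.
Proof. by rewrite (zig_bit false) /orient; lra. Qed.

Lemma zig_half K s : zig K s / 2 = K./2%:R + orient (odd K) (s / 2).
Proof. by rewrite -{1}(odd_double_half K) zig_bit; lra. Qed.

(** A point at parameter [t] of its segment is in the half-cell chosen by
    [2^-1 < t], at time twice the distance from [t] to the nearer end. The centre
    of the segment, at time 1, goes with the first half. *)
Lemma figure_folded p :
  figure_of (@closed_segment R) M p -> zigfig folded (2 * p.1, 2 * p.2).
Proof.
case=> k [l]; case E: (M k l) => //.
- move=> ->; exists k.*2, l.*2, 1; split; first by lra.
    by exists k, l; rewrite /folded_in E.
  by rewrite !zig_double /=; congr (_, _); lra.
- case=> t /=; rewrite in_itv /= => t01 <-; pose h := 2^-1 < t.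
  exists (h + k.*2)%N, (h + l.*2)%N, (2 * orient h t); split.
  + by rewrite /h /orient; case: ltP; lra.
  + by exists k, l; rewrite /folded_in E !half_bit_double !oddD !odd_double.
  + rewrite !zig_bit /segment_point /= -[k.+1%:R]natr1 -[l.+1%:R]natr1.
    by rewrite /h /orient; case: ltP => ? /=; congr (_, _); lra.
- case=> t /=; rewrite in_itv /= => t01 <-; pose h := 2^-1 < t.
  exists (h + k.*2)%N, (~~ h + l.*2)%N, (2 * orient h t); split.
  + by rewrite /h /orient; case: ltP; lra.
  + by exists k, l; rewrite /folded_in E !half_bit_double !oddD !odd_double !oddb !addbF negbK.
  + rewrite !zig_bit /segment_point /= -[k.+1%:R]natr1 -[l.+1%:R]natr1.
    by rewrite /h /orient; case: ltP => ? /=; congr (_, _); lra.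
Qed.

Lemma zig_segment (seg : R * R -> R * R -> set (R * R)) K L s :
    (forall a b, seg a b (segment_point a b (orient (odd K) (s / 2)))) ->
    let p := (zig K s / 2, zig L s / 2) in
  (odd K = odd L ->
     seg (K./2%:R, L./2%:R) (K./2.+1%:R, L./2.+1%:R) p) /\
  (odd K = ~~ odd L ->
     seg (K./2%:R, L./2.+1%:R) (K./2.+1%:R, L./2%:R) p).
Proof.
move=> segt p; split=> oddE; [
  move: (segt (K./2%:R, L./2%:R) (K./2.+1%:R, L./2.+1%:R)) |
  move: (segt (K./2%:R, L./2.+1%:R) (K./2.+1%:R, L./2%:R))].
  congr (seg _ _ _); rewrite /p !zig_half /segment_point /= -oddE.
  rewrite -[K./2.+1%:R]natr1 -[L./2.+1%:R]natr1.
  by rewrite /orient; case: (odd K); congr (_, _); lra.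
congr (seg _ _ _); rewrite /p !zig_half /segment_point /= oddE.
rewrite -[K./2.+1%:R]natr1 -[L./2.+1%:R]natr1.
by rewrite /orient; case: (odd L) => /=; congr (_, _); lra.
Qed.

Lemma folded_figure K L s : 0 <= s <= 1 -> folded K L s ->
  figure_of (@closed_segment R) M (zig K s / 2, zig L s / 2).
Proof.
rewrite /folded /folded_in => s01 [k [l]] Mkl; exists k, l.
have segt a b : closed_segment a b (segment_point a b (orient (odd K) (s / 2))).
  exists (orient (odd K) (s / 2)) => //=; rewrite in_itv /=.
  by rewrite /orient; case: (odd K); lra.
have [segP segM] := zig_segment L segt.
case: (M k l) Mkl => // [[-> -> ->]|[Kk Ll KL]|[Kk Ll KL]].
- by rewrite !zig_double; congr (_, _); lra.
- by rewrite -Kk -Ll; apply: segP.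
- by rewrite -Kk -Ll; apply: segM.
Qed.

Definition fill : 'M[entry]_(m, n) :=
  \matrix_(k, l) if M k l is Bullet then Plus else M k l.

Lemma fill_bullet_free : bullet_free fill.
Proof. by move=> k l; rewrite mxE; case: (M k l). Qed.

(** At positive time a point is off the ends of its segment; a bullet is at the
    centre of the segment that replaces it. *)
Lemma folded_fill K L s : 0 < s <= 1 -> folded K L s ->
  figure_of (@open_segment R) fill (zig K s / 2, zig L s / 2).
Proof.
rewrite /folded /folded_in => s01 [k [l]] Mkl; exists k, l; rewrite mxE.
have segt a b : open_segment a b (segment_point a b (orient (odd K) (s / 2))).
  exists (orient (odd K) (s / 2)) => //=; rewrite in_itv /=.
  by rewrite /orient; case: (odd K); lra.
have [segP segM] := zig_segment L segt.
case: (M k l) Mkl => // [[KE LE _]|[Kk Ll KL]|[Kk Ll KL]].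
- move: segP; rewrite {1 2 3 4}KE {1 2 3 4}LE !odd_double.
  by rewrite KE LE !doubleK => /(_ erefl).
- by rewrite -Kk -Ll; apply: segP.
- by rewrite -Kk -Ll; apply: segM.
Qed.

End Folding.

End Zigzag.

(** * Permutations drawn by words *)

Lemma zig_order_asym K K' (a b : nat) :
  zig_order K K' (a < b) (b < a) -> ~~ zig_order K' K (b < a) (a < b).
Proof.
rewrite /zig_order [K' == K]eq_sym; case: ltngtP => //= <-.
by case: (odd K) => ab; rewrite -leqNgt ltnW.
Qed.

(** Only the order inside a common interval depends on the truth values. *)
Lemma zig_orderW K K' (lt gt lt' gt' : bool) : (lt -> lt') -> (gt -> gt') ->
  zig_order K K' lt gt -> zig_order K K' lt' gt'.
Proof.
move=> ltW gtW /orP[KK|/andP[KK o]]; apply/orP; [by left | right; rewrite KK].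
by case: (odd K) o.
Qed.

(** An order on the index set follows from one implication, by totality of
    the order of the labels. *)
Lemma asym_order_eq n (V : 'I_n -> nat) (r : rel 'I_n) :
    injective V -> (forall i j, r i j -> ~~ r j i) ->
  (forall i j, V i < V j -> r i j) -> forall i j, r i j = (V i < V j).
Proof.
move=> injV asym Vr i j; case: ltngtP => [/Vr //|/Vr/asym/negPf //|/injV->].
by apply: contraTF (isT) => rjj; have := asym _ _ rjj; rewrite rjj.
Qed.

Lemma sorted_blocks (I : eqType) (b : I -> nat) j (s : seq I) :
    sorted (relpre b leq) s ->
  flatten [seq [seq x <- s | b x == a] | a <- iota 0 j] = [seq x <- s | (b x < j)%N].
Proof.
move=> s_sorted; elim: j => [|j IH]; first by elim: s {s_sorted} => //= x s <-.
rewrite -addn1 iotaD map_cat flatten_cat IH /= cats0 add0n addn1.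
elim: s s_sorted {IH} => //= x s IH x_s; have {IH} := IH (path_sorted x_s).
have le_s y : y \in s -> (b x <= b y)%N.
  have leq_b_tr : transitive (relpre b leq) by move=> ? ? ?; apply: leq_trans.
  by move: y; apply/allP; apply: order_path_min x_s.
have none c : (forall y, y \in s -> ~~ c y) -> [seq y <- s | c y] = [::].
  by move=> cs; apply/eqP; rewrite -[_ == _]negbK -has_filter; apply/hasPn.
rewrite ltnS; case: ltngtP => [xj <- //|xj //|xj].
by rewrite none //= => [<- //|y /le_s]; rewrite xj -leqNgt.
Qed.

Lemma all2P (S T : Type) (r : S -> T -> bool) x y (s : seq S) (t : seq T) :
  size s = size t ->
  reflect (forall i, i < size s -> r (nth x s i) (nth y t i)) (all2 r s t).
Proof.
elim: s t => [|a s IH] [|b t] //= => [_|[/IH st]]; first by constructor.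
apply: (iffP andP) => [[ab /st rst] [|i] //= /rst //|rst].
by split; [apply: (rst 0) | apply/st => i; apply: (rst i.+1)].
Qed.

Section Words.
Variables p q : nat.
Notation letter := ('I_p * 'I_q)%type.
Implicit Types (w : seq letter).

(** The [i]-th point of [pi] is carried by the letter of [w] in position
    [f i], which names a half-column and a half-row; the position plays the role of
    time. *)
Definition drawing w (pi : permutation) (f : 'I_(tag pi) -> 'I_(size w)) : Prop :=
  forall i j,
    zig_order (tnth (in_tuple w) (f i)).1 (tnth (in_tuple w) (f j)).1
      (f i < f j) (f j < f i) = (i < j) /\
    zig_order (tnth (in_tuple w) (f i)).2 (tnth (in_tuple w) (f j)).2
      (f i < f j) (f j < f i) = (values pi i < values pi j).

Definition draws w pi : Prop := exists f, @drawing w pi f.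

Lemma subseq_embedding (T : eqType) (u w : seq T) : subseq u w ->
  exists2 h : 'I_(size u) -> 'I_(size w), {mono h : i j / i < j} &
    forall i, tnth (in_tuple w) (h i) = tnth (in_tuple u) i.
Proof.
case: u => [|x0 u0] uw.
  by exists (fun i : 'I_0 => let: Ordinal _ lt0 := i in False_rect _ (notF lt0)); case.
move: (x0 :: u0) uw => u uw.
have [h h_mono hP] : exists2 h : nat -> nat, {mono h : i j / i < j} &
    forall i, i < size u -> h i < size w /\ nth x0 w (h i) = nth x0 u i.
  elim: w u uw => [|y w IH] [|x u] /=; try by exists id.
  case: eqP => [->|_] /IH[h h_mono hP]; last first.
    by exists (fun i => (h i).+1) => [i j|i /hP] //=; rewrite ltnS.
  exists (fun i => if i is i'.+1 then (h i').+1 else 0).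
    by move=> [|i] [|j] //=; rewrite !ltnS.
  by case=> //= i; apply: hP.
exists (fun i : 'I_(size u) => Ordinal (hP i (ltn_ord i)).1) => [i j|i] //=.
by rewrite !(tnth_nth x0) /= (hP i (ltn_ord i)).2.
Qed.

Lemma draws_subseq u w pi : subseq u w -> draws u pi -> draws w pi.
Proof.
move=> /subseq_embedding[h h_mono hP] [f fP].
by exists (h \o f) => i j /=; rewrite !h_mono !hP; apply: fP.
Qed.

(** When every letter is used, [w] carries no points beyond those of [pi], and
    whatever it draws is found inside [pi]. *)
Lemma draws_onto_contains w pi sigma (f : 'I_(tag pi) -> 'I_(size w)) :
  drawing f -> (forall c, exists i, f i = c) -> draws w sigma -> contains pi sigma.
Proof.
move=> fP /choice[f' f'K] [g gP]; exists (f' \o g).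
split=> i j /=; have [gx gy] := gP i j;
  by have := fP (f' (g i)) (f' (g j)); rewrite !f'K gx gy; case.
Qed.

End Words.

Section PatternStrokes.
Local Open Scope ring_scope.
Variables (R : realType) (p q : nat).
Notation letter := ('I_p * 'I_q)%type.
Variable F : seq (letter + {set letter}).

(** What may happen during the [i]-th of the intervals into which time is cut,
    at relative time [t]. The single point of an optional letter is put in the
    middle, where a bullet sits in its cell. *)
Definition slot (i : 'I_(size F)) (a : letter) (t : R) : Prop :=
  match tnth (in_tuple F) i with
  | inl b => a = b /\ t = 2^-1
  | inr A => a \in A
  end.

Definition strokes (K L : nat) (s : R) : Prop :=
  exists (i : 'I_(size F)) (a : letter) t,
    [/\ K = a.1, L = a.2, 0 <= t <= 1, slot i a t & s = (i%:R + t) / (size F)%:R].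

(** Reading the points in order of time gives the word. A factor with an
    optional letter admits one time and one place only, so at most one point
    occurs there. *)
Lemma strokes_draws pi : SubFigure (zigfig strokes) pi ->
  exists w, lang F w /\
    exists2 f, @drawing p q w pi f & forall c, exists i, f i = c.
Proof.
case: pi => n pi [/= P [zigP P1 P2]].
have /choice[y yP] i : exists y : 'I_(size F) * letter * R,
    [/\ 0 <= y.2 <= 1, slot y.1.1 y.1.2 y.2,
        0 <= (y.1.1%:R + y.2) / (size F)%:R <= 1 &
        P i = (zig y.1.2.1 ((y.1.1%:R + y.2) / (size F)%:R),
               zig y.1.2.2 ((y.1.1%:R + y.2) / (size F)%:R))].
  have [K [L [s [s01 [b [a [t [KE LE t01 slt sE]]]] PE]]]] := zigP i.
  by exists (b, a, t); rewrite /= -sE -KE -LE.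
pose a i := (y i).1.2; pose b i := (y i).1.1; pose t i := (y i).2.
pose s i := ((b i)%:R + t i) / (size F)%:R.
have t01 i : 0 <= t i <= 1 by case: (yP i).
have s01 i : 0 <= s i <= 1 by case: (yP i).
have PE i : P i = (zig (a i).1 (s i), zig (a i).2 (s i)) by case: (yP i).
(* The end of one interval and the start of the next are the same time, so
   sorting by time alone might mix the factors. Doubling the weight of the index
   breaks these ties by factor and keeps the order of time. *)
pose key i := 2 * (b i)%:R + t i.
have key_b i j : key i <= key j -> (b i <= b j)%N.
  rewrite /key; have := t01 i; have := t01 j; case: leqP => // ji.
  have : (b j).+1%:R <= (b i)%:R :> R by rewrite ler_nat.
  by rewrite -natr1; lra.
have key_s i j : key i <= key j -> s i <= s j.
  move=> kij; have := key_b _ _ kij; rewrite leq_eqVlt => /predU1P[bij|ltb].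
    move: kij; rewrite /s /key bij lerD2l => tij.
    by rewrite ler_wpM2r ?invr_ge0 // lerD2l.
  rewrite /s ler_wpM2r ?invr_ge0 //; have := t01 i; have := t01 j.
  have : (b i).+1%:R <= (b j)%:R :> R by rewrite ler_nat.
  by rewrite -natr1; lra.
pose Z := sort (relpre key <=%R) (enum 'I_n).
have Z_sorted : sorted (relpre key <=%R) Z.
  by apply: sort_sorted => i j; apply: le_total.
have memZ i : i \in Z by rewrite mem_sort mem_enum.
have Z_uniq : uniq Z by rewrite sort_uniq enum_uniq.
have index_lt i j : s i < s j -> (index i Z < index j Z)%N.
  apply: contraTltn => ij; rewrite -leNgt; apply: key_s.
  apply: (sorted_leq_index _ _ Z_sorted) => //= [? ? ?|?]; first exact: le_trans.
  exact: lexx.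
have indexP i : (index i Z < size (map a Z))%N by rewrite size_map index_mem.
exists (map a Z); split.
  have <- : flatten [seq map a [seq i <- Z | b i == c :> nat]
                    | c <- iota 0 (size F)] = map a Z.
    rewrite (map_comp (map a)) -map_flatten sorted_blocks.
      by rewrite (@eq_filter _ _ predT) ?filter_predT // => i; rewrite /= ltn_ord.
    by apply: sub_sorted Z_sorted => i j; apply: key_b.
  exists [seq map a [seq i <- Z | b i == c :> nat] | c <- iota 0 (size F)] => //.
  pose x0 : letter + {set letter} := inr finset.set0.
  apply/(all2P _ x0 [::]); first by rewrite size_map size_iota.
  move=> c cF; rewrite (nth_map 0%N) ?size_iota // nth_iota // add0n.
  pose c' := Ordinal cF.
  have -> : nth x0 F c = tnth (in_tuple F) c' by rewrite (tnth_nth x0).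
  have slotc i : (b i == c :> nat) -> slot c' (a i) (t i).
    move=> /eqP bic; case: (yP i) => _.
    by rewrite -/(b i) (_ : b i = c') //; apply: val_inj.
  move: slotc; rewrite /slot; case: (tnth _ _) => [x|A] slotc /=; last first.
    by apply/allP=> _ /mapP[i + ->]; rewrite mem_filter => /andP[/slotc].
  have eqc i j : b i = c :> nat -> b j = c :> nat -> i = j.
    move=> bi bj; have [ai ti] := slotc i (introT eqP bi).
    have [aj tj] := slotc j (introT eqP bj).
    have Pij : P i = P j by rewrite (PE i) (PE j) /s ai aj ti tj bi bj.
    have := P1 i j; have := P1 j i; rewrite Pij ltxx.
    by case: (ltngtP i j) => // /val_inj.
  have := filter_uniq (fun i => b i == c :> nat) Z_uniq.
  case E: [seq i <- Z | _] => [|i [|j l]] //=.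
    have : i \in [seq i <- Z | b i == c :> nat] by rewrite E mem_head.
    by rewrite mem_filter => /andP[/slotc[-> _] _]; rewrite eqxx.
  have : i \in [seq i <- Z | b i == c :> nat] by rewrite E mem_head.
  have : j \in [seq i <- Z | b i == c :> nat] by rewrite E !inE eqxx orbT.
  rewrite !mem_filter => /andP[/eqP bj _] /andP[/eqP bi _].
  by rewrite (eqc i j) // mem_head.
exists (fun i => Ordinal (indexP i)) => [i j|c] /=; last first.
  have cZ : (c < size Z)%N by rewrite -(size_map a).
  have cn : (c < n)%N by move: cZ; rewrite size_sort size_enum_ord.
  by exists (nth (Ordinal cn) Z c); apply: val_inj; rewrite /= index_uniq.
have letterE k : tnth (in_tuple (map a Z)) (Ordinal (indexP k)) = a k.
  by rewrite (tnth_nth (a k)) /= (nth_map k) ?nth_index // index_mem.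
rewrite !letterE; split.
- pose r i j := zig_order (a i).1 (a j).1
    (index i Z < index j Z)%N (index j Z < index i Z)%N.
  apply: (@asym_order_eq _ val r) => {i j} [|i j|i j ij].
  - exact: val_inj.
  - exact: zig_order_asym.
  have := P1 i j; rewrite ij !PE => /zig_lt_order-/(_ (s01 i) (s01 j)).
  by apply: zig_orderW; apply: index_lt.
- pose r i j := zig_order (a i).2 (a j).2
    (index i Z < index j Z)%N (index j Z < index i Z)%N.
  apply: (@asym_order_eq _ (fun i => val (pi i)) r) => {i j} [i j|i j|i j ij].
  - by move=> /val_inj/perm_inj.
  - exact: zig_order_asym.
  have := P2 i j; rewrite ij !PE => /zig_lt_order-/(_ (s01 i) (s01 j)).
  by apply: zig_orderW; apply: index_lt.
Qed.

(** The letters of a word of the pattern are performed one after the other, each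
    in the interval of its factor. Times taken from the positions in the whole word
    stay in the open interval, where [zig_ltE] reads the order off exactly. *)
Lemma draws_strokes w pi : lang F w -> draws w pi -> SubFigure (zigfig strokes) pi.
Proof.
case=> ws Fws wE [f fP].
have [szF szws] : size F = size ws /\ size w = sumn (shape ws).
  rewrite wE size_flatten; split=> //.
  by elim: F ws Fws {wE} => [|x G IH] [|u us] //= /andP[_ /IH->].
pose blk (c : nat) := reshape_index (shape ws) c.
have blkF (c : 'I_(size w)) : (blk c < size F)%N.
  by rewrite szF -(size_map size) reshape_indexP // -szws.
pose x0 : letter + {set letter} := inr finset.set0.
pose fixed (c : nat) := if nth x0 F (blk c) is inl _ then true else false.
pose t (c : nat) : R := if fixed c then 2^-1 else c.+1%:R / (size w).+1%:R.
pose s (c : nat) : R := ((blk c)%:R + t c) / (size F)%:R.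
have t01 (c : 'I_(size w)) : 0 < t c < 1.
  rewrite /t; case: ifP => _; first by lra.
  by rewrite divr_gt0 ?ltr0n //= ltr_pdivrMr ?ltr0n // mul1r ltr_nat ltnS.
have s01 (c : 'I_(size w)) : 0 < s c < 1.
  have := t01 c; have := blkF c; rewrite -(ler_nat R) -natr1 => blt tc.
  have ? : 0 <= (blk c)%:R :> R by [].
  by rewrite /s divr_gt0 ?ltr_pdivrMr ?ltr0n ?(leq_trans _ (blkF c)) //; lra.
have fitsP (c : 'I_(size w)) :
    fits (nth x0 F (blk c)) (nth [::] ws (blk c)) /\
    tnth (in_tuple w) c \in nth [::] ws (blk c).
  split; first exact: (elimT (all2P (@fits _) x0 [::] szF) Fws _ (blkF c)).
  set d := tnth _ c; rewrite /d (tnth_nth d) /= [X in nth d X]wE nth_flatten mem_nth //.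
  by rewrite -nth_shape reshape_offsetP // -szws.
have s_lt (c d : 'I_(size w)) : (c < d)%N -> s c < s d.
  move=> cd; rewrite /s ltr_pM2r ?invr_gt0 ?ltr0n ?(leq_trans _ (blkF c)) //.
  have := ltnW cd; rewrite (reshape_leq (shape ws)) => /orP[blt|/andP[/eqP beq ole]].
    have := t01 c; have := t01 d.
    have : (blk c).+1%:R <= (blk d)%:R :> R by rewrite ler_nat.
    by rewrite -natr1; lra.
  rewrite /blk -beq -/(blk c) ltrD2l /t /fixed {2}/blk -beq -/(blk c).
  (* the factor of an optional letter has no room for two positions *)
  case E: (nth x0 F (blk c)) => [a|A]; last first.
    by rewrite ltr_pM2r ?invr_gt0 ?ltr0n // ltr_nat ltnS.
  have := reshape_leq (shape ws) d c.
  rewrite leqNgt cd /= beq ltnn eqxx /= => /esym/negbT.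
  have : (reshape_offset (shape ws) d < size (nth [::] ws (blk c)))%N.
    by rewrite -nth_shape /blk beq reshape_offsetP // -szws.
  by have [+ _] := fitsP c; rewrite E => /size_subseq /=; lia.
have s_ltE (c d : 'I_(size w)) : (s c < s d) = (c < d)%N.
  case: ltngtP => [/s_lt //|/s_lt/ltW|/val_inj->]; last by rewrite ltxx.
  by rewrite leNgt => /negPf.
pose a c := tnth (in_tuple w) c.
exists (fun i => (zig (a (f i)).1 (s (f i)), zig (a (f i)).2 (s (f i)))).
split=> [i|i j|i j] /=; try by rewrite zig_ltE // !s_ltE; case: (fP i j).
exists (a (f i)).1, (a (f i)).2, (s (f i)); split=> //; first by have := s01 (f i); lra.
exists (Ordinal (blkF (f i))), (a (f i)), (t (f i)); split=> //.
  by have := t01 (f i); lra.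
have [] := fitsP (f i); rewrite /slot (tnth_nth x0) /= /t /fixed.
case: (nth x0 F _) => [b|A /allP]; last exact.
rewrite /fits => bu au.
by split=> //; apply/eqP; have := mem_subseq bu au; rewrite inE.
Qed.

End PatternStrokes.

(** * The matrix of a pattern *)

Section Gridding.
Local Open Scope ring_scope.
Variables (R : realType) (p q : nat).
Notation letter := ('I_p * 'I_q)%type.

(** The column occupied by the [i]-th of [j] time intervals in the [k]-th
    zigzag interval: an odd interval is traversed from right to left. *)
Definition subcell (j k i : nat) : nat := (k * j + if odd k then j.-1 - i else i)%N.

Lemma subcell_lt j k n (i : 'I_j) : (k < n)%N -> (subcell j k i < n * j)%N.
Proof.
move=> kn; apply: leq_trans (leq_mul kn (leqnn j)); rewrite mulSnr -addnS leq_add2l.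
by have := ltn_ord i; case: ifP => _; lia.
Qed.

Lemma subcell_inj j k k' (i i' : 'I_j) :
  subcell j k i = subcell j k' i' -> k = k' /\ i = i'.
Proof.
rewrite /subcell; set v := (if odd k then _ else _); set v' := (if odd k' then _ else _).
have vj : (v < j)%N by have := ltn_ord i; rewrite /v; case: ifP => _; lia.
have vj' : (v' < j)%N by have := ltn_ord i'; rewrite /v'; case: ifP => _; lia.
move=> eq_kv; have kk' : k = k'.
  have := congr1 (divn^~ j) eq_kv.
  by rewrite !divnMDl ?(leq_trans _ vj) // !divn_small // !addn0.
split=> //; apply: val_inj => /=; move: eq_kv; rewrite /v /v' kk'.
by have := ltn_ord i; have := ltn_ord i'; case: ifP => _; lia.
Qed.

(** Moving inside one subcolumn, in the direction of its zigzag interval, is the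
    zigzag motion restricted to one time interval and scaled by [j]. *)
Lemma subcell_zig j k (i : 'I_j) (t : R) :
  (subcell j k i)%:R + orient (odd k) t = j%:R * zig k ((i%:R + t) / j%:R).
Proof.
have j0 : (j%:R : R) != 0 by rewrite pnatr_eq0; case: (i) => [? /=]; lia.
rewrite /zig /orient /subcell mulrDr natrD natrM; case: ifP => _.
  rewrite mulrBr [_ * (_ / _)]mulrC divfK // -subn1 -subnDA.
  rewrite natrB ?natrD; last by have := ltn_ord i; lia.
  by rewrite [j%:R * k%:R]mulrC; lra.
by rewrite [_ * (_ / _)]mulrC divfK // [j%:R * k%:R]mulrC addrA.
Qed.

Variable F : seq (letter + {set letter}).
Let j := size F.

(** A cell is nonzero only when its column and its row belong to the same time
    interval. A starred factor fills the cells of its letters, with slope -1 where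
    column and row are traversed in opposite directions. *)
Definition gridding : 'M[entry]_(p * j, q * j) :=
  \matrix_(c, r)
    if [pick x : letter * 'I_j | (c == subcell j x.1.1 x.2 :> nat) &&
                                 (r == subcell j x.1.2 x.2 :> nat)]
    is Some x then
      match tnth (in_tuple F) x.2 with
      | inl b => if x.1 == b then Bullet else Zero
      | inr A => if x.1 \in A then
                   (if odd x.1.1 == odd x.1.2 then Plus else Minus) else Zero
      end
    else Zero.

Variant gridding_spec (c : 'I_(p * j)) (r : 'I_(q * j)) : entry -> Prop :=
| GriddingBullet (a : letter) (i : 'I_j) of c = subcell j a.1 i :> nat &
    r = subcell j a.2 i :> nat & tnth (in_tuple F) i = inl a :
    gridding_spec c r Bullet
| GriddingStroke (a : letter) (i : 'I_j) A of c = subcell j a.1 i :> nat &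
    r = subcell j a.2 i :> nat & tnth (in_tuple F) i = inr A & a \in A :
    gridding_spec c r (if odd a.1 == odd a.2 then Plus else Minus)
| GriddingZero
    of (forall (a : letter) (i : 'I_j),
        c = subcell j a.1 i :> nat -> r = subcell j a.2 i :> nat ->
        match tnth (in_tuple F) i with inl b => a != b | inr A => a \notin A end) :
    gridding_spec c r Zero.

Lemma griddingP c r : gridding_spec c r (gridding c r).
Proof.
rewrite mxE; case: pickP => [[a i] /= /andP[/eqP cE /eqP rE]|none]; last first.
  constructor=> a i cE rE; have := none (a, i).
  by rewrite /= cE rE !eqxx.
have unique (a' : letter) (i' : 'I_j) : c = subcell j a'.1 i' :> nat ->
    r = subcell j a'.2 i' :> nat ->
    a' = a /\ i' = i.
  rewrite cE rE => /subcell_inj[/val_inj E1 ->] /subcell_inj[/val_inj E2 _].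
  by split=> //; rewrite [a]surjective_pairing E1 E2 -surjective_pairing.
case Fi: (tnth _ _) => [b|A]; case: ifP => [|/negbT] ab.
- by move/eqP: ab => ab; apply: (GriddingBullet cE rE); rewrite ab.
- by constructor=> a' i' /unique{}unique /unique[-> ->]; rewrite Fi.
- exact: GriddingStroke Fi ab.
- by constructor=> a' i' /unique{}unique /unique[-> ->]; rewrite Fi.
Qed.

(** Column and row each determine the time interval. In the interval of an
    optional letter the matrix has a single nonzero entry. *)
Lemma gridding_isolated : bullet_isolated gridding.
Proof.
move=> c r; case: griddingP => // [a i cE rE Fi _|a i A _ _ _ _]; last by case: ifP.
split=> [r' r'r|c' c'c].
- case: griddingP => // [b k cE' rE' Fk|b k A cE' rE' Fk bA].
  + case: r'r; apply: val_inj; rewrite /= rE rE'.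
    have [_ ik] := subcell_inj (etrans (esym cE) cE').
    by move: Fk; rewrite -ik Fi => -[->].
  + by have [_ ik] := subcell_inj (etrans (esym cE) cE'); move: Fk; rewrite -ik Fi.
- case: griddingP => // [b k cE' rE' Fk|b k A cE' rE' Fk bA].
  + case: c'c; apply: val_inj; rewrite /= cE cE'.
    have [_ ik] := subcell_inj (etrans (esym rE) rE').
    by move: Fk; rewrite -ik Fi => -[->].
  + by have [_ ik] := subcell_inj (etrans (esym rE) rE'); move: Fk; rewrite -ik Fi.
Qed.

(** The parameter of a segment of the matrix runs from left to right, whereas
    time runs against it in the odd zigzag intervals. *)
Lemma gridding_strokes x :
  figure_of (@closed_segment R) gridding x ->
  zigfig (strokes F) (j%:R^-1 * x.1, j%:R^-1 * x.2).
Proof.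
case=> c [r].
have jP (i : 'I_j) : 0 < (j%:R : R) by rewrite ltr0n; case: (i) => /= *; lia.
have scaled (a : letter) (i : 'I_j) (t : R) : 0 <= t <= 1 -> slot i a t ->
    zigfig (strokes F) (j%:R^-1 * ((subcell j a.1 i)%:R + orient (odd a.1) t),
                        j%:R^-1 * ((subcell j a.2 i)%:R + orient (odd a.2) t)).
  move=> t01 sl; have {jP} j0 := jP i; rewrite !subcell_zig !mulKf ?gt_eqF //.
  exists a.1, a.2, ((i%:R + t) / j%:R); split=> //; last by exists i, a, t.
  have : i.+1%:R <= j%:R :> R by rewrite ler_nat.
  rewrite -natr1 ler_pdivrMr // mul1r => le_j; have := ler0n R i => i0.
  by rewrite divr_ge0 ?ler0n //=; lra.
clear jP; case: griddingP => // [a i cE rE Fi ->|a i A cE rE Fi aA] /=.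
  have half01 : 0 <= (2^-1 : R) <= 1 by lra.
  have half b : orient b 2^-1 = 2^-1 :> R by rewrite /orient; case: b => //; lra.
  by have := scaled a i _ half01; rewrite !half -cE -rE; apply; rewrite /slot Fi.
have slA (t : R) : slot i a t by rewrite /slot Fi.
case: eqP => oddE [t /=]; rewrite in_itv /= => t01 <-; rewrite /segment_point /=;
  have t01' : 0 <= orient (odd a.1) t <= 1 by rewrite /orient; case: (odd a.1); lra.
- have := scaled a i _ t01' (slA _); rewrite -cE -rE -[c.+1%:R]natr1 -[r.+1%:R]natr1.
  by congr (zigfig _ (_ * _, _ * _)); rewrite /orient -?oddE; case: (odd a.1); lra.
- have := scaled a i _ t01' (slA _); rewrite -cE -rE -[c.+1%:R]natr1 -[r.+1%:R]natr1.
  congr (zigfig _ (_ * _, _ * _)); rewrite /orient; move: oddE;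
    by case: (odd a.1); case: (odd a.2); lra.
Qed.

Lemma strokes_gridding x : zigfig (strokes F) x ->
  figure_of (@closed_segment R) gridding (j%:R * x.1, j%:R * x.2).
Proof.
case=> K [L [s [s01 [i [a [t [-> -> t01 sl ->]]]] -> /=]]].
rewrite -!subcell_zig.
pose c := Ordinal (subcell_lt i (ltn_ord a.1)).
pose r := Ordinal (subcell_lt i (ltn_ord a.2)).
have t01' : 0 <= orient (odd a.1) t <= 1 by rewrite /orient; case: (odd a.1); lra.
exists c, r; case: griddingP => [b k cE rE Fk|b k A cE rE Fk bA|none].
- have [_ ik] := subcell_inj (cE : subcell j a.1 i = _).
  move: sl; rewrite /slot ik Fk -ik => -[_ ->].
  by rewrite /c /r /orient /= -/j; congr (_, _); case: ifP => _; lra.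
- have [/val_inj E1 ik] := subcell_inj (cE : subcell j a.1 i = _).
  have [/val_inj E2 _] := subcell_inj (rE : subcell j a.2 i = _).
  rewrite -E1 -E2 /c /r /= -/j; case: eqP => oddE;
    exists (orient (odd a.1) t); rewrite /= ?in_itv //.
    rewrite /segment_point /= -oddE -[(subcell _ a.1 _).+1%:R]natr1.
    rewrite -[(subcell _ a.2 _).+1%:R]natr1.
    by congr (_, _); lra.
  rewrite /segment_point /= -[(subcell _ a.1 _).+1%:R]natr1.
  rewrite -[(subcell _ a.2 _).+1%:R]natr1.
  rewrite /orient; move: oddE; case: (odd a.1); case: (odd a.2) => // _;
    by congr (_, _); lra.
have := none a i erefl erefl; move: sl; rewrite /slot.
by case: (tnth _ _) => [b [-> _]|A ->]; rewrite ?eqxx.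
Qed.

Lemma Geom_bullet_gridding pi :
  Geom_bullet R gridding pi <-> SubFigure (zigfig (@strokes R _ _ F)) pi.
Proof.
have [j0|j0] := posnP j; last first.
  have jR : 0 < (j%:R : R) by rewrite ltr0n.
  split; first by apply: (SubFigure_rescale _ gridding_strokes); rewrite invr_gt0.
  exact: (SubFigure_rescale jR strokes_gridding).
(* the empty pattern: both figures are empty *)
have noslot (i : 'I_j) : False by case: i => i; rewrite j0.
split; apply: (SubFigure_rescale ltr01) => x.
  by case/gridding_strokes=> [? [? [? [_ [i]]]]]; case: (noslot i).
by case=> [? [? [? [_ [i]]]]]; case: (noslot i).
Qed.

End Gridding.

(** * Joint embedding *)

Lemma SubFigure_class (R : realType) (F : set (R * R)) :
  permutation_class (SubFigure F).
Proof.
move=> pi sigma [p [Fp p1 p2]] [f [f_mono fv]]; exists (p \o f).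
by split=> [i|i j|i j] /=; [apply: Fp | rewrite p1 f_mono | rewrite p2 fv].
Qed.

Lemma SubFigure_neq0 (R : realType) (F : set (R * R)) : SubFigure F !=set0.
Proof.
pose empty : permutation := existT (fun n => 'S_n) 0 1%g.
exists empty; exists (fun=> (0%R, 0%R)).
by split=> [[]|[]|[]].
Qed.

Lemma index_sort_lt (R : realType) (T : eqType) (f : T -> R) (s : seq T) :
    {in s &, injective f} -> let fs := sort (relpre f <=%R) s in
  {in s &, forall x y, (index x fs < index y fs) = (f x < f y)%R}.
Proof.
move=> injf fs x y xs ys.
have fs_sorted : sorted (relpre f <=%R) fs by apply: sort_sorted => ? ?; apply: le_total.
have index_le u v : u \in s -> v \in s -> index u fs <= index v fs -> (f u <= f v)%R.
  move=> us vs; apply: (sorted_leq_index _ _ fs_sorted); rewrite ?mem_sort //.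
    by move=> ? ? ?; apply: le_trans.
  by move=> ?; apply: lexx.
have [fxy|fyx|/injf-> //] := ltgtP (f x) (f y); last by rewrite ltnn.
  by apply: contraTT fxy; rewrite -leqNgt -leNgt; apply: index_le.
by apply: contraTF fyx => /ltnW; rewrite -leNgt; apply: index_le.
Qed.

(** The label of a point is its rank when the points are sorted by height, and
    its position is its rank when they are sorted from left to right. *)
Lemma standardize (R : realType) (F : set (R * R)) (Z : seq (R * R)) :
    {in Z, forall z, F z} ->
    {in Z &, injective fst} -> {in Z &, injective snd} ->
  exists pi, exists p : 'I_(tag pi) -> R * R,
    [/\ SubFigure F pi,
        forall i j, ((p i).1 < (p j).1)%R = (i < j),
        forall i j, ((p i).2 < (p j).2)%R = (values pi i < values pi j) &
        {in Z, forall z, exists i, p i = z}].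
Proof.
move=> FZ inj1 inj2; pose U := undup Z; pose N := size U.
have UZ z : z \in U -> z \in Z by rewrite mem_undup.
pose Z1 := sort (relpre fst <=%R) U; pose Z2 := sort (relpre snd <=%R) U.
pose p (i : 'I_N) := nth (0, 0)%R Z1 i.
have pU i : p i \in U by rewrite -(mem_sort (relpre fst <=%R)) mem_nth // size_sort.
have index1 i : index (p i) Z1 = i.
  by rewrite index_uniq ?size_sort ?sort_uniq ?undup_uniq.
have rank_lt i : index (p i) Z2 < N.
  by have := index_mem (p i) Z2; rewrite size_sort mem_sort pU.
pose rank i := Ordinal (rank_lt i).
have rank_inj : injective rank.
  move=> i j [rij]; apply: val_inj; rewrite /= -(index1 i) -(index1 j); congr (index _ _).
  have Z2p k : nth (0, 0)%R Z2 (index (p k) Z2) = p k by rewrite nth_index // mem_sort.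
  by rewrite -Z2p rij Z2p.
have p1 i j : ((p i).1 < (p j).1)%R = (i < j).
  rewrite -(index1 i) -(index1 j) index_sort_lt // => u v /UZ uZ /UZ vZ; exact: inj1.
have p2 i j : ((p i).2 < (p j).2)%R = (perm rank_inj i < perm rank_inj j).
  rewrite !permE /= index_sort_lt // => u v /UZ uZ /UZ vZ; exact: inj2.
exists (existT _ N (perm rank_inj)), p; split=> //.
  by exists p; split=> // i; apply/FZ/UZ/pU.
move=> z zZ; have zN : index z Z1 < N.
  by have := index_mem z Z1; rewrite size_sort mem_sort mem_undup zZ.
by exists (Ordinal zN); rewrite /p nth_index // mem_sort mem_undup.
Qed.

Section Joint.
Local Open Scope ring_scope.
Variables (R : realType).
Implicit Types (K L : nat) (b : bool) (s c : R).

(** Times of ordinary points are compressed, increasingly, into an interval of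
    length 1/6 inside (0, 1); for [c = 1] and [c = 3] these intervals are
    disjoint. Bullets ([b] true) keep time 1. *)
Definition squeeze c b s : R := if b then 1 else (c + s) / 6.

(** What bullet-isolation says of the abscissas, or of the ordinates, of two
    points: a bullet shares its column with no point but itself. *)
Definition compatible K b s K' b' s' : Prop :=
  [/\ 0 <= s <= 1, 0 <= s' <= 1, b -> s = 1 /\ ~~ odd K, b' -> s' = 1 /\ ~~ odd K' &
      b || b' -> K./2 = K'./2 -> [/\ K = K', b & b']].

Lemma squeeze01 c b s : 1 <= c <= 3 -> 0 <= s <= 1 -> 0 <= squeeze c b s <= 1.
Proof. by rewrite /squeeze; case: b; lra. Qed.

Lemma zig_range K s : 0 <= s <= 1 -> 2 * K./2%:R <= zig K s <= 2 * K./2%:R + 2.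
Proof.
by have := zig_half K s; rewrite /orient; case: (odd K); lra.
Qed.

Lemma zig_bullet K : ~~ odd K -> zig K 1 = 2 * K./2%:R + 1 :> R.
Proof.
by move=> /negPf K_even; have := @zig_half R K 1; rewrite /orient K_even; lra.
Qed.

(** A bullet is in the middle of its cell, away from the neighbouring cells,
    hence strictly separated from them even if the other point is on a boundary. *)
Lemma squeeze_lt c c' K b s K' b' s' : 1 <= c <= 3 -> 1 <= c' <= 3 ->
    compatible K b s K' b' s' -> b || b' -> (K./2 < K'./2)%N ->
  zig K (squeeze c b s) < zig K' (squeeze c' b' s').
Proof.
move=> c13 c'13 [s01 s'01 bP b'P _] bb' KK'.
have := zig_range K (squeeze01 b c13 s01); have := zig_range K' (squeeze01 b' c'13 s'01).
have : K./2.+1%:R <= K'./2%:R :> R by rewrite ler_nat.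
rewrite -natr1 /squeeze.
case: b bP bb' => [/(_ isT)[_ /zig_bullet bE] _|_ /= b'T]; first by rewrite !bE; lra.
by rewrite b'T; have [_ /zig_bullet b'E] := b'P b'T; rewrite !b'E; lra.
Qed.

Lemma compatible_sym K b s K' b' s' :
  compatible K b s K' b' s' -> compatible K' b' s' K b s.
Proof. by move=> [? ? ? ? e]; split=> //; rewrite orbC => /e{}e /esym/e[]. Qed.

Lemma squeeze_mono c K b s K' b' s' :
    1 <= c <= 3 -> compatible K b s K' b' s' ->
  zig K s < zig K' s' -> zig K (squeeze c b s) < zig K' (squeeze c b' s').
Proof.
move=> c13 comp lt_ss'; have [s01 s'01 bP b'P bbP] := comp.
case bb': (b || b'); last first.
  move/norP: (negbT bb') => [/negPf-> /negPf->]; rewrite /squeeze zig_ltE; try lra.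
  by move/(zig_lt_order s01 s'01): lt_ss'; apply: zig_orderW => ?; lra.
have [KK'|KK'|KK'] := ltngtP K./2 K'./2; first exact: squeeze_lt bb' KK'.
  have := zig_range K s01; have := zig_range K' s'01.
  have : K'./2.+1%:R <= K./2%:R :> R by rewrite ler_nat.
  by rewrite -natr1; lra.
have [E bT b'T] := bbP bb' KK'.
have [s1 _] := bP bT; have [s'1 _] := b'P b'T.
by move: lt_ss'; rewrite E s1 s'1 ltxx.
Qed.

(** Two ordinary points have squeezed times in disjoint intervals inside (0, 1),
    hence different coordinates. *)
Lemma squeeze_merge K b s K' b' s' : compatible K b s K' b' s' ->
  zig K (squeeze 1 b s) = zig K' (squeeze 3 b' s') -> [/\ K = K', b & b'].
Proof.
move=> comp eq_zig; have [s01 s'01 bP b'P bbP] := comp.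
case bb': (b || b').
  have [KK'|KK'|KK'] := ltngtP K./2 K'./2; last exact: bbP.
    suff : zig K (squeeze 1 b s) < zig K' (squeeze 3 b' s') by rewrite eq_zig ltxx.
    by apply: squeeze_lt KK'; rewrite // ; lra.
  suff : zig K' (squeeze 3 b' s') < zig K (squeeze 1 b s) by rewrite eq_zig ltxx.
  by apply: squeeze_lt KK'; rewrite 1?orbC //; [lra|lra|apply: compatible_sym].
move/norP: (negbT bb') => [/negPf bF /negPf b'F].
move: eq_zig; rewrite bF b'F /squeeze => eq_zig.
have r1 : 0 < (1 + s) / 6 < 1 by lra.
have r3 : 0 < (3 + s') / 6 < 1 by lra.
have := zig_ltE K K' r1 r3; have := zig_ltE K' K r3 r1.
have r13 : (1 + s) / 6 < (3 + s') / 6 by lra.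
by rewrite eq_zig ltxx /zig_order r13; case: ltngtP => //= ->; case: (odd K).
Qed.

Variables (m n : nat) (M : 'M[entry]_(m, n)).
Hypothesis M_isolated : bullet_isolated M.

Definition is_bullet (e : entry) : bool := if e is Bullet then true else false.

Lemma folded_in_half (k : 'I_m) (l : 'I_n) K L s : folded_in M k l K L s ->
  [/\ K./2 = k, L./2 = l & M k l <> Zero].
Proof.
rewrite /folded_in; case: (M k l) => // -[] //.
by move=> -> -> _; rewrite !doubleK.
Qed.

Lemma folded_in_squeeze c (k : 'I_m) (l : 'I_n) K L s : folded_in M k l K L s ->
  folded_in M k l K L (squeeze c (is_bullet (M k l)) s).
Proof. by rewrite /folded_in; case: (M k l) => // -[-> -> _]. Qed.

Lemma folded_in_bullet (k : 'I_m) (l : 'I_n) K L s :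
  folded_in M k l K L s -> is_bullet (M k l) ->
  [/\ K = k.*2, L = l.*2 & s = 1].
Proof. by rewrite /folded_in; case: (M k l). Qed.

Lemma is_bulletP e : is_bullet e -> e = Bullet. Proof. by case: e. Qed.

Lemma isolated_eq (k k' : 'I_m) (l l' : 'I_n) : M k' l' <> Zero -> is_bullet (M k l) ->
  k = k' \/ l = l' -> k = k' /\ l = l'.
Proof.
move=> M'0 /is_bulletP/M_isolated[col row] [ek|el]; split=> //; apply: contrapT => ne.
  by case: M'0; rewrite -ek; apply: col => /esym.
by case: M'0; rewrite -el; apply: row => /esym.
Qed.

Section Compatible.
Variables (k k' : 'I_m) (l l' : 'I_n) (K L K' L' : nat) (s s' : R).
Hypotheses (fkl : folded_in M k l K L s) (fkl' : folded_in M k' l' K' L' s').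
Let b := is_bullet (M k l).
Let b' := is_bullet (M k' l').

Lemma folded_in_same : b || b' -> K./2 = K'./2 \/ L./2 = L'./2 ->
  [/\ b, b', K = K' & L = L'].
Proof.
have [-> -> M0] := folded_in_half fkl.
have [-> -> M'0] := folded_in_half fkl' => bb' eq_kl.
have {}eq_kl : k = k' \/ l = l' by case: eq_kl => /val_inj; [left | right].
have [ek el] : k = k' /\ l = l'.
  case/orP: bb' => [bT|b'T]; first exact: isolated_eq bT eq_kl.
  have eq_lk : k' = k \/ l' = l by case: eq_kl => ->; [left | right].
  by have [-> ->] := isolated_eq M0 b'T eq_lk.
have bT : b by move: bb'; rewrite /b /b' -ek -el orbb.
have b'T : b' by rewrite /b' -ek -el.
have [-> -> _] := folded_in_bullet fkl bT; have [-> -> _] := folded_in_bullet fkl' b'T.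
by rewrite ek el.
Qed.

Hypotheses (s01 : 0 <= s <= 1) (s'01 : 0 <= s' <= 1).

Lemma compatible_col : compatible K b s K' b' s'.
Proof.
split=> // [/(folded_in_bullet fkl)[-> _ ->]|/(folded_in_bullet fkl')[-> _ ->]|bb' eq_k].
- by rewrite odd_double.
- by rewrite odd_double.
by have [] := folded_in_same bb' (or_introl eq_k).
Qed.

Lemma compatible_row : compatible L b s L' b' s'.
Proof.
split=> // [/(folded_in_bullet fkl)[_ -> ->]|/(folded_in_bullet fkl')[_ -> ->]|bb' eq_l].
- by rewrite odd_double.
- by rewrite odd_double.
by have [] := folded_in_same bb' (or_intror eq_l).
Qed.

End Compatible.

(** Realisations that can be moved: the half-cells of the points are kept, and
    the squeezed times still give [pi] for every admissible [c]. *)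
Lemma squeeze_figure pi : Geom_bullet R M pi ->
  exists (k : 'I_(tag pi) -> 'I_m) (l : 'I_(tag pi) -> 'I_n)
         (K L : 'I_(tag pi) -> nat) (s : 'I_(tag pi) -> R),
    [/\ forall i, 0 <= s i <= 1, forall i, folded_in M (k i) (l i) (K i) (L i) (s i) &
        forall c, 1 <= c <= 3 ->
          let t i := squeeze c (is_bullet (M (k i) (l i))) (s i) in
          (forall i j, (zig (K i) (t i) < zig (K j) (t j)) = (i < j)%N) /\
          (forall i j, (zig (L i) (t i) < zig (L j) (t j)) =
                       (values pi i < values pi j)%N)].
Proof.
move=> /(SubFigure_rescale (ltr0n _ 2) (@figure_folded _ _ _ M))[p [zp p1 p2]].
have /choice[y yP] i : exists y : 'I_m * 'I_n * nat * nat * R,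
    [/\ 0 <= y.2 <= 1, folded_in M y.1.1.1.1 y.1.1.1.2 y.1.1.2 y.1.2 y.2 &
        p i = (zig y.1.1.2 y.2, zig y.1.2 y.2)].
  by have [K [L [s [s01 [k [l fkl]] pE]]]] := zp i; exists (k, l, K, L, s).
exists (fun i => (y i).1.1.1.1), (fun i => (y i).1.1.1.2), (fun i => (y i).1.1.2),
  (fun i => (y i).1.2), (fun i => (y i).2).
split=> [i|i|c c13 t]; try by case: (yP i).
split.
- apply: (@asym_order_eq _ val (fun i j => zig (y i).1.1.2 (t i) < zig (y j).1.1.2 (t j))).
  + exact: val_inj.
  + by move=> i j /ltW; rewrite leNgt.
  move=> i j; rewrite -p1; have [si fi ->] := yP i; have [sj fj ->] := yP j.
  exact: squeeze_mono c13 (compatible_col fi fj si sj).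
- apply: (@asym_order_eq _ (fun i => val (values pi i))
            (fun i j => zig (y i).1.2 (t i) < zig (y j).1.2 (t j))).
  + by move=> i j /val_inj/perm_inj.
  + by move=> i j /ltW; rewrite leNgt.
  move=> i j; rewrite -p2; have [si fi ->] := yP i; have [sj fj ->] := yP j.
  exact: squeeze_mono c13 (compatible_row fi fj si sj).
Qed.

(** The union of the realisation of [pi] squeezed with [c = 1] and that of
    [sigma] squeezed with [c = 3] has no two points on a common vertical or
    horizontal line, since the only points that meet are common bullets. *)
Lemma joint_embedding pi sigma : Geom_bullet R M pi -> Geom_bullet R M sigma ->
  exists tau, [/\ Geom_bullet R M tau, contains tau pi & contains tau sigma].
Proof.
move=> /squeeze_figure[k [l [K [L [s [s01 fkl sq]]]]]].
move=> /squeeze_figure[k' [l' [K' [L' [s' [s'01 fkl' sq']]]]]].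
have {sq} := sq 1 ltac:(lra); have {sq'} := sq' 3 ltac:(lra).
set t' := fun i => squeeze 3 _ _; set t := fun i => squeeze 1 _ _.
move=> /= [x' y'] [x y].
pose P i := (zig (K i) (t i), zig (L i) (t i)).
pose P' i := (zig (K' i) (t' i), zig (L' i) (t' i)).
pose Z := codom P ++ codom P'.
have FZ : {in Z, forall z, zigfig (folded M) z}.
  move=> z; rewrite mem_cat => /orP[] /codomP[i ->].
    exists (K i), (L i), (t i); split=> //; first by apply: squeeze01; [lra|].
    by exists (k i), (l i); apply: folded_in_squeeze.
  exists (K' i), (L' i), (t' i); split=> //; first by apply: squeeze01; [lra|].
  by exists (k' i), (l' i); apply: folded_in_squeeze.
have same i j : K i = K' j /\ L i = L' j -> is_bullet (M (k i) (l i)) ->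
    is_bullet (M (k' j) (l' j)) -> P i = P' j.
  by move=> [EK EL] bi bj; rewrite /P /P' /t /t' /squeeze bi bj EK EL.
have cross1 i j : (P i).1 = (P' j).1 -> P i = P' j.
  move/(squeeze_merge (compatible_col (fkl i) (fkl' j) (s01 i) (s'01 j))) => [EK bi bj].
  have [|_ _ _ EL] := folded_in_same (fkl i) (fkl' j) _ (or_introl (congr1 half EK)).
    by rewrite bi.
  exact: same.
have cross2 i j : (P i).2 = (P' j).2 -> P i = P' j.
  move/(squeeze_merge (compatible_row (fkl i) (fkl' j) (s01 i) (s'01 j))) => [EL bi bj].
  have [|_ _ EK _] := folded_in_same (fkl i) (fkl' j) _ (or_intror (congr1 half EL)).
    by rewrite bi.
  exact: same.
have inj1 : {in Z &, injective fst}.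
  move=> u v; rewrite !mem_cat => /orP[] /codomP[i ->] /orP[] /codomP[j ->] eq_ij.
  - have := x i j; have := x j i; move: eq_ij => /= ->; rewrite ltxx.
    by case: ltngtP => // /val_inj->.
  - exact: cross1.
  - by apply/esym/cross1.
  - have := x' i j; have := x' j i; move: eq_ij => /= ->; rewrite ltxx.
    by case: ltngtP => // /val_inj->.
have inj2 : {in Z &, injective snd}.
  move=> u v; rewrite !mem_cat => /orP[] /codomP[i ->] /orP[] /codomP[j ->] eq_ij.
  - have := y i j; have := y j i; move: eq_ij => /= ->; rewrite ltxx.
    by case: ltngtP => // /val_inj/perm_inj->.
  - exact: cross2.
  - by apply/esym/cross2.
  - have := y' i j; have := y' j i; move: eq_ij => /= ->; rewrite ltxx.
    by case: ltngtP => // /val_inj/perm_inj->.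
have [tau [p [Ftau p1 p2 pZ]]] := standardize FZ inj1 inj2.
exists tau; split.
- apply: (@SubFigure_rescale _ 2^-1 _ _ _ _ _ Ftau); last first.
    move=> _ [K0 [L0 [s0 [s001 f0 ->]]]]; rewrite /= ![2^-1 * _]mulrC.
    exact: folded_figure.
  by rewrite invr_gt0.
- have /choice[f fP] i : exists j, p j = P i by apply: pZ; rewrite mem_cat codom_f.
  by exists f; split=> i j; [rewrite -p1 !fP x | rewrite -p2 !fP y].
- have /choice[f fP] i : exists j, p j = P' i by apply: pZ; rewrite mem_cat codom_f orbT.
  by exists f; split=> i j; [rewrite -p1 !fP x' | rewrite -p2 !fP y'].
Qed.

Lemma Geom_bullet_sub_fill : Geom_bullet R M `<=` Geom R (fill M).
Proof.
move=> pi /squeeze_figure[k [l [K [L [s [s01 fkl sq]]]]]].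
have := sq 1 ltac:(lra); set t := fun i => squeeze 1 _ _; move=> /= [x y].
exists (fun i => (zig (K i) (t i) / 2, zig (L i) (t i) / 2)).
split=> [i|i j|i j] /=; rewrite ?ltr_pM2r ?invr_gt0 ?ltr0n ?x ?y //.
apply: folded_fill; last by exists (k i), (l i); apply: folded_in_squeeze.
by have := s01 i; rewrite /t /squeeze; case: is_bullet; lra.
Qed.

(** If [D] misses [pi] and [E] misses [sigma], a permutation of the class
    containing both belongs to neither. *)
Lemma Geom_bullet_atomic : atomic (Geom_bullet R M).
Proof.
split; [exact: SubFigure_class | exact: SubFigure_neq0 |].
move=> [D [E [D_class E_class [DC CD] [EC CE] DE]]].
move/existsNP: CD => [pi /not_implyP[Cpi nDpi]].
move/existsNP: CE => [sigma /not_implyP[Csigma nEsigma]].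
have [tau [Ctau tau_pi tau_sigma]] := joint_embedding Cpi Csigma.
move: Ctau; rewrite DE => -[Dtau|Etau].
  exact/nDpi/D_class/tau_pi.
exact/nEsigma/E_class/tau_sigma.
Qed.

Lemma Geom_bullet_griddable : geometrically_griddable R (Geom_bullet R M).
Proof.
split; first exact: SubFigure_class.
by exists m, n, (fill M); split; [exact: fill_bullet_free | exact: Geom_bullet_sub_fill].
Qed.

End Joint.

(** * Decomposition of griddable classes *)

(** Otherwise [C] would be the union of the proper subclasses [C `&` D] and
    [C `&` E]. *)
Lemma atomic_sub_union (C D E : set permutation) :
    atomic C -> permutation_class D -> permutation_class E ->
  C `<=` D `|` E -> C `<=` D \/ C `<=` E.
Proof.
move=> [C_class _ C_irr] D_class E_class CDE.
apply: contrapT => /not_orP[CD CE]; apply: C_irr; exists (C `&` D), (C `&` E).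
have classI (B : set permutation) : permutation_class B -> permutation_class (C `&` B).
  move=> B_class pi sigma [Cpi Bpi] pi_sigma.
  by split; [apply: C_class Cpi pi_sigma | apply: B_class Bpi pi_sigma].
split; try exact: classI.
- by split; [exact: subIsetl | rewrite subsetI => -[]].
- by split; [exact: subIsetl | rewrite subsetI => -[]].
by rewrite -setIUr; apply/esym/setIidPl.
Qed.

Lemma atomic_sub_bigcup (I : eqType) (s : seq I) (A : I -> set permutation) C :
    atomic C -> (forall i, permutation_class (A i)) ->
  C `<=` \bigcup_(i in [set` s]) A i -> exists2 i, i \in s & C `<=` A i.
Proof.
move=> C_atomic A_class; elim: s => [|i s IH] Cs.
  by have [_ [pi /Cs[i]]] := C_atomic.
have [|||CA|/IH[j js CA]] :=
  @atomic_sub_union C (A i) (\bigcup_(j in [set` s]) A j) C_atomic.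
- exact: A_class.
- by move=> pi sigma [j js Aj] pi_sigma; exists j => //; apply: A_class pi_sigma.
- move=> pi /Cs[j]; rewrite /= inE => /predU1P[->|js] Aj; [by left | by right; exists j].
- by exists i; rewrite ?mem_head.
by exists j; rewrite // inE js orbT.
Qed.

Section Decomposition.
Variable R : realType.

(** The pattern with one starred factor over all letters allows every half-cell
    at all times. *)
Lemma Geom_strokes m n (M : 'M[entry]_(m, n)) : bullet_free M ->
  Geom R M `<=` SubFigure (zigfig (@strokes R m.*2 n.*2 [:: inr [set: _]%SET])).
Proof.
move=> M_free; apply: (@SubFigure_rescale R 2); first by rewrite ltr0n.
move=> x xM; have : figure_of (@closed_segment R) M x.
  case: xM => k [l xkl]; exists k, l; move: xkl; have := M_free k l.
  case: (M k l) => // _ [t t01 <-]; exists t => //;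
    by move: t01; rewrite /= !in_itv /= => /andP[/ltW-> /ltW->].
move/figure_folded=> [K [L [s [s01 [k [l fkl]] ->]]]].
have [Kk Ll _] := folded_in_half fkl.
have Km : K < m.*2 by have := ltn_ord k; rewrite -Kk; lia.
have Ln : L < n.*2 by have := ltn_ord l; rewrite -Ll; lia.
exists K, L, s; split=> //; exists ord0, (Ordinal Km, Ordinal Ln), s.
by split=> //; [rewrite /slot /= inE | rewrite /= add0r divr1].
Qed.

(** The language consists of the words that draw only permutations of [C].
    A permutation of [C] is drawn by one of them, because a word read off its
    points draws nothing that it does not contain. *)
Lemma griddable_decomposition (C : set permutation) :
    geometrically_griddable R C ->
  exists p q (Fs : seq (seq (('I_p * 'I_q) + {set 'I_p * 'I_q}))),
    C = \bigcup_(i in [set: 'I_(size Fs)])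
          Geom_bullet R (gridding (tnth (in_tuple Fs) i)).
Proof.
case=> C_class [m [n [M [M_free CM]]]].
pose L (w : seq ('I_m.*2 * 'I_n.*2)) := forall pi, draws w pi -> C pi.
have L_sub u w : subseq u w -> L w -> L u.
  by move=> uw Lw pi u_pi; apply: Lw; apply: draws_subseq u_pi.
have [Fs FsP] := finite_union_patterns [:: inr [set: _]%SET] L_sub.
exists m.*2, n.*2, Fs; apply/seteqP; split=> pi.
  move=> Cpi; have pi_strokes := Geom_strokes M_free (CM _ Cpi).
  have [w [Fw [f f_draws f_onto]]] := strokes_draws pi_strokes.
  have Lw : L w.
    by move=> sigma /(draws_onto_contains f_draws f_onto); apply: C_class.
  have [G GFs Gw] := (FsP w).1 (conj Fw Lw).
  have /tnthP[i Gi] : G \in in_tuple Fs by [].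
  exists i => //; rewrite -Gi; apply/Geom_bullet_gridding.
  by apply: draws_strokes Gw _; exists f.
case=> i _ /Geom_bullet_gridding/strokes_draws[w [Gw [f f_draws _]]].
have [_ Lw] : lang [:: inr [set: _]%SET] w /\ L w.
  by apply/FsP; exists (tnth (in_tuple Fs) i) => //; apply: mem_tnth.
by apply: Lw; exists f.
Qed.

End Decomposition.

Theorem theorem10p3 (R : realType) :
  (forall C : set permutation,
     (atomic C /\ geometrically_griddable R C) <->
     (exists (m n : nat) (M : 'M[entry]_(m, n)),
        bullet_isolated M /\ C = Geom_bullet R M)) /\
  (forall C : set permutation,
     geometrically_griddable R C ->
     exists (N : nat) (m n : 'I_N -> nat)
            (M : forall i : 'I_N, 'M[entry]_(m i, n i)),
       (forall i, bullet_isolated (M i)) /\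
       C = \bigcup_(i in [set: 'I_N]) Geom_bullet R (M i)).
Proof.
split=> C; last first.
  move=> /griddable_decomposition[p [q [Fs CE]]].
  exists (size Fs), (fun i => p * size (tnth (in_tuple Fs) i)),
    (fun i => q * size (tnth (in_tuple Fs) i)),
    (fun i => gridding (tnth (in_tuple Fs) i)).
  by split=> // i; apply: gridding_isolated.
split=> [[C_atomic /griddable_decomposition[p [q [Fs CE]]]]|[m [n [M [M_isolated ->]]]]].
  pose A i := Geom_bullet R (gridding (tnth (in_tuple Fs) i)).
  have [||i _ CA] := @atomic_sub_bigcup _ (enum 'I_(size Fs)) A C C_atomic.
  - by move=> i; apply: SubFigure_class.
  - by rewrite CE => pi [i _ Ai]; exists i; rewrite //= mem_enum.
  exists _, _, (gridding (tnth (in_tuple Fs) i)); split; first exact: gridding_isolated.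
  by apply/seteqP; split=> // pi Api; rewrite CE; exists i.
by split; [apply: Geom_bullet_atomic | apply: Geom_bullet_griddable].
Qed.
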